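(* Let $d$ be a nonnegative integer and let $G$ be an arbitrary finite simple $d$-regular graph. In the Walker-Breaker degree game played on $E(G)$, Breaker has a strategy which guarantees, against every play of Walker, that at the end of the game $\deg_B(v)\ge\lfloor d/3\rfloor$ for every $v\in V(G)$, where $\deg_B(v)$ is the number of edges incident to $v$ claimed by Breaker.
   Context: Walker-Breaker degree game on a simple graph $G$: two players, Walker (acting as Maker) and Breaker, alternately claim one previously unclaimed edge of $G$ per turn until all edges are claimed. Walker opens the game by claiming an initial edge $e_1$, thereby walking along it from one endpoint to the other (its terminal endpoint). In each later turn Walker must claim an unoccupied edge $e_{i+1}$ incident to the terminal endpoint of Walker's previously claimed edge $e_i$, and moves along it to its other endpoint, so that Walker's edges form a continuous walk in $G$. If at any point Walker has reached a vertex from which no unclaimed incident edges remain, Walker is permitted to start a new walk by selecting an arbitrary unoccupied edge (again traversed from one endpoint to the other). Breaker may claim any unclaimed edge of the whole graph in each of Breaker's turns. *)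

(* Defs.v *)
From mathcomp Require Import all_boot.

Set Implicit Arguments.
Unset Strict Implicit.
Unset Printing Implicit Defensive.

(** A finite simple graph on [V : finType] is given by a
    symmetric irreflexive adjacency relation [adj : rel V]; an edge is the
    two-element set of its endpoints. *)

Definition edges (V : finType) (adj : rel V) : {set {set V}} :=
  [set [set p.1; p.2] | p : V * V & adj p.1 p.2].

Definition regular (V : finType) (adj : rel V) (d : nat) : Prop :=
  forall v : V, #|[set u | adj v u]| = d.

(** [Walk x y]: Walker claims the edge [[set x; y]], walking from [x] to [y].
    [Claim f]: Breaker claims the edge [f]. *)
Inductive move (V : finType) : Type :=
  | Walk of V & V
  | Claim of {set V}.

Arguments Walk {V}.
Arguments Claim {V}.

(** Moves in chronological order; Walker plays the first move. *)
Definition history (V : finType) : Type := seq (move V).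

Definition walker_edges (V : finType) (h : history V) : {set {set V}} :=
  \bigcup_(m <- h) (if m is Walk x y then [set [set x; y]] else set0).

Definition breaker_edges (V : finType) (h : history V) : {set {set V}} :=
  \bigcup_(m <- h) (if m is Claim f then [set f] else set0).

Definition free_edges (V : finType) (adj : rel V) (h : history V) :
    {set {set V}} :=
  edges adj :\: (walker_edges h :|: breaker_edges h).

(** [None] before Walker's opening move. *)
Definition walker_at (V : finType) (h : history V) : option V :=
  foldl (fun pos m => if m is Walk _ y then Some y else pos) None h.

(** Walker may start from an arbitrary vertex in the opening move, or when no
    free edge is incident to the current vertex. *)
Definition may_walk_from (V : finType) (adj : rel V) (h : history V) (x : V) :
    Prop :=
  if walker_at h is Some v then
    x = v \/ (forall f, f \in free_edges adj h -> v \notin f)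
  else True.

(** A strategy depends on the whole history; its values matter only at legal
    histories in which Breaker is to move. *)
Definition breaker_strategy (V : finType) : Type := history V -> {set V}.

(** Legal, possibly unfinished, plays in which Breaker's moves follow [s].
    Breaker is to move after an odd number of moves. *)
Inductive play (V : finType) (adj : rel V) (s : breaker_strategy V) :
    history V -> Prop :=
  | play_start : play adj s [::]
  | play_walker h x y :
      play adj s h -> ~~ odd (size h) ->
      [set x; y] \in free_edges adj h -> may_walk_from adj h x ->
      play adj s (rcons h (Walk x y))
  | play_breaker h :
      play adj s h -> odd (size h) ->
      s h \in free_edges adj h ->
      play adj s (rcons h (Claim (s h))).

(** Without this condition an illegal answer of [s] would merely block the
    play instead of counting against Breaker. *)
Definition legal_strategy (V : finType) (adj : rel V)
    (s : breaker_strategy V) : Prop :=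
  forall h, play adj s h -> odd (size h) -> free_edges adj h != set0 ->
    s h \in free_edges adj h.

Definition complete_play (V : finType) (adj : rel V)
    (s : breaker_strategy V) (h : history V) : Prop :=
  play adj s h /\ free_edges adj h = set0.

Definition breaker_degree (V : finType) (h : history V) (v : V) : nat :=
  #|[set f in breaker_edges h | v \in f]|.

(* Main.v *)
Require Import Defs.
From mathcomp Require Import all_boot.
From mathcomp Require Import zify.

(** Breaker answers at the vertex that Walker has just left: after a Walker
    move from [x] to [y], Breaker takes a free edge at [x] when there is one,
    and an arbitrary free edge otherwise.

    Consider a vertex [v].  Walker leaves [v] after every arrival there, unless
    [v] has no free edge left, so Walker's edges at [v] come in pairs (one in,
    one out), with at most one departure missing, and a walk that starts at [v]
    only adds a departure.  Each departure from [v] is answered at [v] unless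
    [v] has just become saturated.  Hence, as long as [v] has a free edge,
    Walker's degree at [v] exceeds twice Breaker's degree only by a
    temporary slack: [1] while Walker stands at [v], and [2] between a departure
    from [v] and its answer ([walker_degree_le_slack]).  A Walker move that uses
    up the last edge at [v] is made while Walker's excess is at most [1], so
    Walker's final degree at [v] is at most twice Breaker's plus [2]
    ([walker_degree_le]).  As the two degrees add up to [d] at the end, [d] is
    at most three times Breaker's degree plus [2], which is the claim. *)

Section DegreeGame.

Variables (V : finType) (adj : rel V).
Implicit Types (h : history V) (v x y : V) (f : {set V}).

Definition walker_degree h v : nat := #|[set f in walker_edges h | v \in f]|.

(** The vertex at which Breaker owes an answer. *)
Definition departed h : option V :=
  foldl (fun _ m => if m is Walk x _ then Some x else None) None h.

Definition answer_at_departed : breaker_strategy V := fun h =>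
  let free := free_edges adj h in
  let at_departed f := if departed h is Some x then x \in f else false in
  if [pick f in free | at_departed f] is Some f then f
  else odflt set0 [pick f in free].

Definition slack h v : nat :=
  (walker_at h == Some v) + (departed h == Some v).*2.

Lemma answer_free h :
  free_edges adj h != set0 -> answer_at_departed h \in free_edges adj h.
Proof.
rewrite /answer_at_departed => /set0Pn[f free_f].
case: pickP => [g /andP[]//|_]; case: pickP => [//|no_free].
by rewrite no_free in free_f.
Qed.

Lemma answer_incident h v f :
  departed h = Some v -> f \in free_edges adj h -> v \in f ->
  v \in answer_at_departed h.
Proof.
rewrite /answer_at_departed => -> free_f vf.
case: pickP => [g /andP[]//|no_free].
by have := no_free f; rewrite free_f vf.
Qed.

Lemma departed_even s h : play adj s h -> ~~ odd (size h) -> departed h = None.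
Proof.
case=> [//|h' x y _ even_h' _ _|h' _ _ _ _]; first by rewrite size_rcons /= even_h'.
by rewrite /departed foldl_rcons.
Qed.

Lemma walker_edges_walk h x y :
  walker_edges (rcons h (Walk x y)) = [set x; y] |: walker_edges h.
Proof. by rewrite /walker_edges big_rcons /= setUC. Qed.

Lemma walker_edges_claim h f :
  walker_edges (rcons h (Claim f)) = walker_edges h.
Proof. by rewrite /walker_edges big_rcons /= setU0. Qed.

Lemma breaker_edges_walk h x y :
  breaker_edges (rcons h (Walk x y)) = breaker_edges h.
Proof. by rewrite /breaker_edges big_rcons /= setU0. Qed.

Lemma breaker_edges_claim h f :
  breaker_edges (rcons h (Claim f)) = f |: breaker_edges h.
Proof. by rewrite /breaker_edges big_rcons /= setUC. Qed.

Lemma free_edges_rcons h m :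
  free_edges adj (rcons h m) \subset free_edges adj h.
Proof.
apply: setDS; case: m => [x y|f].
  by rewrite walker_edges_walk breaker_edges_walk -setUA subsetUr.
by rewrite walker_edges_claim breaker_edges_claim setUCA subsetUr.
Qed.

Lemma card_incident_setU1 (E : {set {set V}}) f v :
  #|[set g in f |: E | v \in g]| =
    (v \in f) && (f \notin E) + #|[set g in E | v \in g]|.
Proof.
have [vf|vf] := boolP (v \in f).
  rewrite (_ : finset _ = f |: [set g in E | v \in g]).
    by rewrite cardsU1 inE vf andbT.
  by apply/setP=> g; rewrite !inE; case: eqP => [->|//]; rewrite vf.
congr #|pred_of_set _|; apply/setP=> g; rewrite !inE.
by case: eqP => [->|//]; rewrite (negPf vf) !andbF.
Qed.

Lemma walker_degree_walk h x y v :
  walker_degree (rcons h (Walk x y)) v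
    <= (v \in [set x; y]) + walker_degree h v.
Proof.
rewrite /walker_degree walker_edges_walk card_incident_setU1 leq_add2r.
by case: (v \in _); case: (_ \notin _).
Qed.

Lemma walker_degree_claim h f v :
  walker_degree (rcons h (Claim f)) v = walker_degree h v.
Proof. by rewrite /walker_degree walker_edges_claim. Qed.

Lemma breaker_degree_walk h x y v :
  breaker_degree (rcons h (Walk x y)) v = breaker_degree h v.
Proof. by rewrite /breaker_degree breaker_edges_walk. Qed.

Lemma breaker_degree_claim h f v : f \in free_edges adj h ->
  breaker_degree (rcons h (Claim f)) v = (v \in f) + breaker_degree h v.
Proof.
rewrite !inE negb_or -andbA => /and3P[_ fB _].
by rewrite /breaker_degree breaker_edges_claim card_incident_setU1 fB andbT.
Qed.

(** Slack never drops unpaid at a vertex that still has a free edge.  In a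
    Walker move it can drop only at the vertex where Walker stood, when Walker
    starts a new walk elsewhere, and then that vertex is saturated.  In a
    Breaker move it drops at the departed vertex, where the answer adds a
    Breaker edge if a free edge is left. *)
Lemma walker_degree_le_slack h v f : irreflexive adj ->
  play adj answer_at_departed h -> f \in free_edges adj h -> v \in f ->
  walker_degree h v <= (breaker_degree h v).*2 + slack h v.
Proof.
move=> adj_irr play_h; elim: play_h f => {h}.
- by move=> f _ _; rewrite /walker_degree /walker_edges big_nil setIdE set0I cards0.
- move=> h x y play_h IHh even_h free_xy from_x f /(subsetP (free_edges_rcons _ _)).
  move=> free_f vf; have := IHh f free_f vf; have := walker_degree_walk h x y v.
  rewrite breaker_degree_walk /slack (departed_even _ _ play_h even_h).
  rewrite /departed /walker_at !foldl_rcons -/(walker_at h) !(inj_eq Some_inj).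
  have x_neq_y : x != y.
    have : [set x; y] \in edges adj by move: free_xy; rewrite inE => /andP[].
    case/imsetP=> -[a b]; rewrite inE /= => adj_ab eq_xy.
    apply/eqP=> eq_x_y; move: eq_xy adj_ab; rewrite {}eq_x_y setUid => eq_y.
    have /set1P-> : a \in [set y] by rewrite eq_y set21.
    have /set1P-> : b \in [set y] by rewrite eq_y set22.
    by rewrite adj_irr.
  (* A vertex with a free edge can be Walker's position only if Walker leaves
     it in this move. *)
  have at_v : walker_at h = Some v -> v = x.
    move=> at_h; move: from_x; rewrite /may_walk_from at_h.
    by case=> [->//|/(_ f free_f)]; rewrite vf.
  rewrite !inE (eq_sym x) (eq_sym y); case: (walker_at h =P Some v) => [/at_v->|_].
    by rewrite eqxx (negPf x_neq_y) /=; lia.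
  by case: (v =P x) => [->|_]; rewrite ?(negPf x_neq_y) /=; lia.
- move=> h play_h IHh odd_h free_s f /(subsetP (free_edges_rcons _ _)) free_f vf.
  have := IHh f free_f vf; rewrite walker_degree_claim breaker_degree_claim //.
  rewrite /slack /departed /walker_at !foldl_rcons -/(walker_at h) -/(departed h).
  case: (departed h =P Some v) => [dep|_]; last lia.
  by rewrite (answer_incident _ _ _ dep free_f vf); lia.
Qed.

(** A new Walker edge at [v] was free beforehand, when Walker was to move and
    the slack of [v] was therefore at most [1]. *)
Lemma walker_degree_le h v : irreflexive adj ->
  play adj answer_at_departed h ->
  walker_degree h v <= (breaker_degree h v).*2 + 2.
Proof.
move=> adj_irr; elim=> {h}.
- by rewrite /walker_degree /walker_edges big_nil setIdE set0I cards0.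
- move=> h x y play_h IHh even_h free_xy _; have := walker_degree_walk h x y v.
  rewrite breaker_degree_walk; have [v_xy|_] := boolP (v \in _); last lia.
  have := walker_degree_le_slack h v _ adj_irr play_h free_xy v_xy.
  by rewrite /slack (departed_even _ _ play_h even_h) /=; lia.
- move=> h play_h IHh odd_h free_s.
  by rewrite walker_degree_claim breaker_degree_claim //; lia.
Qed.

Lemma regular_le_incident d v : irreflexive adj -> regular adj d ->
  d <= #|[set f in edges adj | v \in f]|.
Proof.
move=> adj_irr /(_ v) <-.
rewrite -(@card_in_imset _ _ (fun u => [set v; u])); last first.
  move=> u u'; rewrite !inE => adj_vu _ eq_vu.
  have : u \in [set v; u'] by rewrite -eq_vu set22.
  by case/set2P=> // eq_uv; rewrite eq_uv adj_irr in adj_vu.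
apply/subset_leq_card/subsetP=> f /imsetP[u]; rewrite inE => adj_vu ->.
by rewrite inE set21 andbT; apply/imsetP; exists (v, u); rewrite ?inE.
Qed.

Lemma incident_le_degrees h v : free_edges adj h = set0 ->
  #|[set f in edges adj | v \in f]| <= walker_degree h v + breaker_degree h v.
Proof.
move/eqP; rewrite setD_eq0 => /subsetP all_claimed.
apply: leq_trans (leq_card_setU _ _); apply/subset_leq_card/subsetP=> f.
by rewrite !inE => /andP[/all_claimed]; rewrite inE => + ->; rewrite !andbT.
Qed.

End DegreeGame.

Theorem theorem10 (d : nat) (V : finType) (adj : rel V)
    (adj_sym : symmetric adj) (adj_irr : irreflexive adj)
    (adj_reg : regular adj d) :
  exists s : breaker_strategy V,
    legal_strategy adj s /\
    (forall h : history V, complete_play adj s h ->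
       forall v : V, d %/ 3 <= breaker_degree h v).
Proof.
exists (answer_at_departed V adj); split=> [h _ _|h [play_h full_h] v].
  exact: answer_free.
have d_le := leq_trans (regular_le_incident _ _ d v adj_irr adj_reg)
                       (incident_le_degrees _ _ h v full_h).
have := walker_degree_le _ _ h v adj_irr play_h; lia.
Qed.
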